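(* $\textsc{Circle-Recognition}$ belongs to $\mathsf{dMAM}[\log n]$: there is a three-interaction (Merlin–Arthur–Merlin) distributed interactive protocol with certificates and messages of $\mathcal{O}(\log n)$ bits that decides whether the connected $n$-node network $G$ is a circle graph, with completeness and soundness error at most $1/3$.
   Context: A circle graph is the intersection graph of a family of chords of a circle. $\textsc{Circle-Recognition}$ is the set of configurations $\langle G,\mathrm{id}\rangle$ with $G$ a circle graph. Distributed setting: $G=(V,E)$ is a simple connected $n$-node graph, each node has a unique identifier in $\{1,\dots,\mathrm{poly}(n)\}$, nodes know only a polynomial upper bound on $n$. A $\mathsf{dMAM}[f(n)]$ protocol: an untrusted, computationally unbounded prover (Merlin) who knows the whole configuration gives each node a certificate; then a public random string $r$ shared by all nodes (and seen by Merlin) is drawn; then Merlin gives each node a second certificate depending on $r$; finally, in one deterministic round each node sends one message to each neighbor (depending on its id, input, $r$ and certificates) and accepts or rejects. Certificates and messages have $\mathcal{O}(f(n))$ bits. Completeness: if $G$ is in the class, some prover makes all nodes accept with probability $\ge 2/3$. Soundness: if not, for every prover some node rejects with probability $\ge 2/3$. *)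

(* Defs.v *)
From mathcomp Require Import all_boot.
From Stdlib Require Rdefinitions.
Notation R := Rdefinitions.R.
Notation Rplus := Rdefinitions.Rplus.
Notation Rmult := Rdefinitions.Rmult.
Notation Rminus := Rdefinitions.Rminus.
Notation Rle := Rdefinitions.Rle.
Notation R0 := Rdefinitions.R0.
Notation R1 := Rdefinitions.R1.

Set Implicit Arguments.
Unset Strict Implicit.
Unset Printing Implicit Defensive.

Definition simple_graph (n : nat) (adj : rel 'I_n) : Prop :=
  (forall u v, adj u v = adj v u) /\ (forall v, adj v v = false).

Definition connected_graph (n : nat) (adj : rel 'I_n) : Prop :=
  forall u v, connect adj u v.

Definition point := (R * R)%type.

Definition on_circle (p : point) : Prop :=
  Rplus (Rmult p.1 p.1) (Rmult p.2 p.2) = R1.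

Definition seg_pt (p q : point) (t : R) : point :=
  (Rplus (Rmult (Rminus R1 t) p.1) (Rmult t q.1),
   Rplus (Rmult (Rminus R1 t) p.2) (Rmult t q.2)).

Definition in_unit_interval (t : R) : Prop := Rle R0 t /\ Rle t R1.

Definition chords_intersect (a1 b1 a2 b2 : point) : Prop :=
  exists t s, in_unit_interval t /\ in_unit_interval s /\
              seg_pt a1 b1 t = seg_pt a2 b2 s.

Definition circle_graph (n : nat) (adj : rel 'I_n) : Prop :=
  exists a b : 'I_n -> point,
    (forall v, on_circle (a v) /\ on_circle (b v) /\ a v <> b v) /\
    (forall u v, u <> v -> (adj u v <-> chords_intersect (a u) (b u) (a v) (b v))).

Definition bits := seq bool.

(* A dMAM protocol.  All nodes know the common upper bound N on n.
   - rlen N : length of the public random string r;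
   - msg N id r c1 c2 : the message a node with identifier id, holding
     certificates c1 (first Merlin round) and c2 (second Merlin round),
     sends to each of its neighbours;
   - dec N id r c1 c2 recv : the node's decision, where recv m is the number
     of neighbours that sent the message m (the multiset of received messages). *)
Record protocol := Protocol {
  rlen : nat -> nat;
  msg  : nat -> nat -> bits -> bits -> bits -> bits;
  dec  : nat -> nat -> bits -> bits -> bits -> (bits -> nat) -> bool }.

Definition budget (K n : nat) : nat := K * (trunc_log 2 n).+1.

Definition cert_bounded (K n : nat) (c : 'I_n -> bits) : Prop :=
  forall v, size (c v) <= budget K n.

Definition all_accept (P : protocol) (N n : nat) (adj : rel 'I_n)
    (id : 'I_n -> nat) (c1 c2 : 'I_n -> bits) (r : bits) : bool :=
  [forall v : 'I_n,
     dec P N (id v) r (c1 v) (c2 v)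
       (fun m => #|[set u : 'I_n | adj v u && (msg P N (id u) r (c1 u) (c2 u) == m)]|)].

Definition valid_config (c0 N n : nat) (adj : rel 'I_n) (id : 'I_n -> nat) : Prop :=
  0 < n /\ n <= N <= n ^ c0 /\ simple_graph adj /\ connected_graph adj /\
  injective id /\ (forall v, 1 <= id v <= n ^ c0).

Definition messages_bounded (c0 K : nat) (P : protocol) : Prop :=
  forall n N i r c1 c2, 0 < n -> n <= N <= n ^ c0 -> 1 <= i <= n ^ c0 ->
    size r = rlen P N -> size c1 <= budget K n -> size c2 <= budget K n ->
    size (msg P N i r c1 c2) <= budget K n.

(* Completeness: on circle graphs some prover (first certificates c1, then
   second certificates c2 r depending on the public random string r) makes all
   nodes accept with probability >= 2/3 (r uniform over bit strings of length
   rlen P N). *)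
Definition completeness (c0 K : nat) (P : protocol) : Prop :=
  forall N n (adj : rel 'I_n) (id : 'I_n -> nat),
    valid_config c0 N adj id -> circle_graph adj ->
    exists c1 : 'I_n -> bits, cert_bounded K c1 /\
    exists c2 : bits -> 'I_n -> bits, (forall r, cert_bounded K (c2 r)) /\
      2 * 2 ^ (rlen P N) <=
      3 * #|[set r : (rlen P N).-tuple bool | all_accept P N adj id c1 (c2 (val r)) (val r)]|.

Definition soundness (c0 K : nat) (P : protocol) : Prop :=
  forall N n (adj : rel 'I_n) (id : 'I_n -> nat),
    valid_config c0 N adj id -> ~ circle_graph adj ->
    forall c1 : 'I_n -> bits, cert_bounded K c1 ->
    forall c2 : bits -> 'I_n -> bits, (forall r, cert_bounded K (c2 r)) ->
      2 * 2 ^ (rlen P N) <=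
      3 * #|[set r : (rlen P N).-tuple bool | ~~ all_accept P N adj id c1 (c2 (val r)) (val r)]|.

(* Main.v *)
(* A circle graph is represented by a sequence of 2n distinct chord ends.  Merlin
   first gives each node the two ends l < r of its chord and the numbers of chords
   that are open at these ends.  Each node checks that its neighbours cross its
   chord and that the number of neighbours crossing it on the right minus the
   number crossing it on the left equals the difference of these two numbers.  If
   the numbers are correct, no crossing pair is missing: the leftmost chord with a
   missing neighbour could only miss right neighbours, which breaks the balance.

   The positions and the numbers of open chords are correct when the pairs
   (position, open chords) before the ends, together with (2n, 0), are the pairs
   after the ends, together with (0, 0); it is enough to know this modulo 2.  The
   public coins define a random Boolean function on pairs, Merlin aggregates its
   values along a spanning tree committed to in the first round, and the root
   checks that the total vanishes; two independent functions give error 1/4. *)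

From Stdlib Require Import Reals Lra Psatz.
Require Import Defs.
From mathcomp Require Import all_boot zify.

Set Implicit Arguments.
Unset Strict Implicit.
Unset Printing Implicit Defensive.

(** * Chords of the unit circle *)

Local Open Scope R_scope.

(** Twice the signed area of the triangle [p q c]: its sign tells on which side of the line [p q]
    the point [c] lies. *)
Definition orient (p q c : point) : R :=
  (q.1 - p.1) * (c.2 - p.2) - (q.2 - p.2) * (c.1 - p.1).

Lemma opposite_signs_convex0 (a b : R) : a * b <= 0 ->
  exists s, in_unit_interval s /\ (1 - s) * a + s * b = 0.
Proof.
suff H x y : x < y -> x * y <= 0 ->
    exists s, in_unit_interval s /\ (1 - s) * x + s * y = 0.
  move=> Hab; have [E|[Hlt|Hlt]] : a = b \/ a < b \/ b < a by lra.
  - by exists 0; split; [split; lra | nra].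
  - exact: H.
  - have [|s [[Hs0 Hs1] Hs]] := H _ _ Hlt; first by nra.
    by exists (1 - s); split; [split; lra | lra].
move=> Hlt Hxy; have [Hx Hy] : x <= 0 /\ 0 <= y by nra.
exists (- x / (y - x)); split; last by field; lra.
split; first by apply: Rle_mult_inv_pos; lra.
suff: 0 <= y / (y - x) by move=> H; rewrite (_ : _ / _ = 1 - y / (y - x)); [lra | field; lra].
by apply: Rle_mult_inv_pos; lra.
Qed.

(* The line through two points of the circle leaves the disk exactly at these
   points, so only the chord [c d] has to be tested against the line [p q]. *)
Lemma chords_intersectP (p q c d : point) :
  on_circle p -> on_circle q -> on_circle c -> on_circle d -> p <> q ->
  chords_intersect p q c d <-> orient p q c * orient p q d <= 0.
Proof.
case: p q c d => [p1 p2] [q1 q2] [c1 c2] [d1 d2].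
rewrite /on_circle /orient /= => Hp Hq Hc Hd Hpq.
set D := (q1 - p1) * (q1 - p1) + (q2 - p2) * (q2 - p2).
have Dpos : 0 < D.
  have sq x y : x <> y -> 0 < (y - x) * (y - x).
    by move=> H; apply: (Rlt_0_sqr (y - x)); lra.
  rewrite /D; have [E1|/sq E1] := Req_dec p1 q1; last by nra.
  have [E2|/sq E2] := Req_dec p2 q2; last by nra.
  by case: Hpq; rewrite E1 E2.
set oc := (X in X * _ <= _); set od := (X in _ * X <= _).
split.
  move=> [t [s [[Ht0 Ht1] [[Hs0 Hs1] [E1 E2]]]]]; move: E1 E2; rewrite /= => E1 E2.
  have E : (1 - s) * oc + s * od = 0.
    transitivity ((q1 - p1) * ((1 - s) * c2 + s * d2 - p2) -
                  (q2 - p2) * ((1 - s) * c1 + s * d1 - p1)).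
      by rewrite /oc /od; ring.
    by rewrite -E1 -E2; ring.
  clearbody oc od.
  (* The product expands to [(1 - s) * (oc * oc) + s * (od * od) + oc * od], so its vanishing forces
     [oc * od <= 0]. *)
  have : (oc + od) * ((1 - s) * oc + s * od) = 0 by rewrite E; ring.
  have Hoc : 0 <= oc * oc by nra.
  have Hod : 0 <= od * od by nra.
  by nra.
move=> /opposite_signs_convex0 [s [[Hs0 Hs1] Hs]].
set x := (1 - s) * c1 + s * d1; set y := (1 - s) * c2 + s * d2.
have Hxy : x * x + y * y <= 1.
  have -> : x * x + y * y = (1 - s) * (1 - s) * (c1 * c1 + c2 * c2) +
    s * s * (d1 * d1 + d2 * d2) + 2 * (s * (1 - s)) * (c1 * d1 + c2 * d2).
    by rewrite /x /y; ring.
  have H1 : c1 * d1 + c2 * d2 <= 1.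
    by have := Rle_0_sqr (c1 - d1); have := Rle_0_sqr (c2 - d2); rewrite /Rsqr; lra.
  have H2 : 0 <= s * (1 - s) by nra.
  by rewrite Hc Hd; have := Rmult_le_compat_l _ _ _ H2 H1; lra.
have line : (q1 - p1) * (y - p2) = (q2 - p2) * (x - p1).
  apply: Rminus_diag_uniq; rewrite -Hs /oc /od /x /y; ring.
(* Parameter of the orthogonal projection of [(x, y)] on the line [p q], which contains that point
   by [line]. *)
set t := ((x - p1) * (q1 - p1) + (y - p2) * (q2 - p2)) / D.
have Ex : x = (1 - t) * p1 + t * q1.
  suff: D * (x - p1) = D * (t * (q1 - p1)) by move/Rmult_eq_reg_l; lra.
  have -> : D * (t * (q1 - p1)) = ((x - p1) * (q1 - p1) + (y - p2) * (q2 - p2)) * (q1 - p1).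
    by rewrite /t; field; lra.
  transitivity ((q1 - p1) * (q1 - p1) * (x - p1) + (q2 - p2) * ((q2 - p2) * (x - p1))).
    by rewrite /D; ring.
  by rewrite -line; ring.
have Ey : y = (1 - t) * p2 + t * q2.
  suff: D * (y - p2) = D * (t * (q2 - p2)) by move/Rmult_eq_reg_l; lra.
  have -> : D * (t * (q2 - p2)) = ((x - p1) * (q1 - p1) + (y - p2) * (q2 - p2)) * (q2 - p2).
    by rewrite /t; field; lra.
  transitivity ((q1 - p1) * ((q1 - p1) * (y - p2)) + (q2 - p2) * (q2 - p2) * (y - p2)).
    by rewrite /D; ring.
  by rewrite line; ring.
(* One minus the squared norm of the point is [t * (1 - t) * D], so a point of the disk has its
   parameter in the unit interval. *)
have Ht : 0 <= t * (1 - t).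
  have : x * x + y * y = 1 - t * (1 - t) * D.
    rewrite Ex Ey /D.
    transitivity ((1 - t) * (p1 * p1 + p2 * p2) + t * (q1 * q1 + q2 * q2)
                  - t * (1 - t) * ((q1 - p1) * (q1 - p1) + (q2 - p2) * (q2 - p2))).
      by ring.
    by rewrite Hp Hq; ring.
  by move=> E; apply: (Rmult_le_reg_r D) => //; lra.
exists t, s; split; last split => //; first by split; nra.
by rewrite /seg_pt /= -Ex -Ey.
Qed.

(** Tangent of half the polar angle, that is, stereographic projection from (-1, 0); [circle_pt] is
    the inverse map. *)
Definition slope (p : point) : R := p.2 / (1 + p.1).

(* The order of the circle cut at (-1, 0), which is its least element. *)
Definition before (p q : point) : Prop :=
  (p.1 = -1 /\ q.1 <> -1) \/ (p.1 <> -1 /\ q.1 <> -1 /\ slope p < slope q).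

Definition circle_pt (t : R) : point :=
  ((1 - t * t) / (1 + t * t), 2 * t / (1 + t * t)).

Lemma circle_pt_on (t : R) : on_circle (circle_pt t).
Proof. by rewrite /on_circle /=; field; nra. Qed.

Lemma circle_pt_neqN1 (t : R) : (circle_pt t).1 <> -1.
Proof.
move=> /= H; have : (1 - t * t) / (1 + t * t) * (1 + t * t) = - (1 + t * t) by rewrite H; ring.
by rewrite /Rdiv Rmult_assoc Rinv_l; nra.
Qed.

Lemma slopeK (t : R) : slope (circle_pt t) = t.
Proof. by rewrite /slope /=; field; split; nra. Qed.

Lemma before_circle_pt (s t : R) : before (circle_pt s) (circle_pt t) <-> s < t.
Proof.
rewrite /before !slopeK; have := @circle_pt_neqN1 s; have := @circle_pt_neqN1 t.
by tauto.
Qed.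

Lemma circle_ptK (p : point) : on_circle p -> p.1 <> -1 -> p = circle_pt (slope p).
Proof.
case: p => x y; rewrite /on_circle /circle_pt /slope /= => H Hx.
have Hx' : 1 + x <> 0 by lra.
have E : 1 + y / (1 + x) * (y / (1 + x)) = 2 / (1 + x).
  have -> : 1 + y / (1 + x) * (y / (1 + x)) = ((1 + x) * (1 + x) + y * y) / ((1 + x) * (1 + x)).
    by field.
  have -> : y * y = 1 - x * x by lra.
  by field.
rewrite E; have -> : y / (1 + x) * (y / (1 + x)) = 2 / (1 + x) - 1 by lra.
by congr (_, _); field.
Qed.

Lemma circle_N1 (p : point) : on_circle p -> p.1 = -1 -> p = (-1, 0).
Proof. by case: p => x y; rewrite /on_circle /= => H E; congr (_, _); nra. Qed.

Lemma before_irr (p : point) : ~ before p p.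
Proof. by rewrite /before; lra. Qed.

Lemma before_trans (q p r : point) : before p q -> before q r -> before p r.
Proof. by rewrite /before; lra. Qed.

Lemma before_total (p q : point) : on_circle p -> on_circle q ->
  before p q \/ before q p \/ p = q.
Proof.
move=> Hp Hq; rewrite /before.
have [Ep|Ep] := Req_dec p.1 (-1); have [Eq|Eq] := Req_dec q.1 (-1); try tauto.
  by right; right; rewrite (circle_N1 Hp Ep) (circle_N1 Hq Eq).
have [H|[H|H]] := Rtotal_order (slope p) (slope q); try tauto.
by right; right; rewrite (circle_ptK Hp Ep) H -circle_ptK.
Qed.

Lemma orient_rot (p q c : point) : orient p q c = orient q c p.
Proof. by rewrite /orient; ring. Qed.

Lemma orient_cut (u v : R) : u < v -> 0 < orient (-1, 0) (circle_pt u) (circle_pt v).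
Proof.
move=> Huv.
have -> : orient (-1, 0) (circle_pt u) (circle_pt v) =
    (v - u) * (4 / ((1 + u * u) * (1 + v * v))).
  by rewrite /orient /=; field; split; nra.
apply: Rmult_lt_0_compat; first by lra.
by apply: Rdiv_lt_0_compat; [lra | apply: Rmult_lt_0_compat; nra].
Qed.

(** The orientation is a Vandermonde product of the parameters over a positive denominator;
    [orient_cut] is the limit where the first parameter tends to minus infinity. *)
Lemma orient_circle_pt (u v w : R) : u < v -> v < w ->
  0 < orient (circle_pt u) (circle_pt v) (circle_pt w).
Proof.
move=> Huv Hvw.
have -> : orient (circle_pt u) (circle_pt v) (circle_pt w) =
    ((v - u) * (w - v)) * ((w - u) * (4 / ((1 + u * u) * (1 + v * v) * (1 + w * w)))).
  by rewrite /orient /=; field; repeat split; nra.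
apply: Rmult_lt_0_compat; first by apply: Rmult_lt_0_compat; lra.
apply: Rmult_lt_0_compat; first by lra.
apply: Rdiv_lt_0_compat; first by lra.
by do 2?apply: Rmult_lt_0_compat; nra.
Qed.

Lemma orient_before (p q c : point) :
  on_circle p -> on_circle q -> on_circle c -> before p q -> before q c ->
  0 < orient p q c.
Proof.
move=> Hp Hq Hc Hpq Hqc.
have Eq : q.1 <> -1 by move: Hpq; rewrite /before; lra.
have Ec : c.1 <> -1 by move: Hqc; rewrite /before; lra.
have Sqc : slope q < slope c by move: Hqc; rewrite /before; lra.
have [Ep|Ep] := Req_dec p.1 (-1).
  by rewrite (circle_N1 Hp Ep) (circle_ptK Hq Eq) (circle_ptK Hc Ec); apply: orient_cut.
rewrite (circle_ptK Hp Ep) (circle_ptK Hq Eq) (circle_ptK Hc Ec).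
by apply: orient_circle_pt => //; move: Hpq; rewrite /before; lra.
Qed.

(** Points strictly between [p] and [q] in the cut order lie on the negative side of the line [p q],
    points strictly outside on the positive side, so only two ends on the same open side avoid an
    intersection. *)
Lemma chords_intersect_before (p q c d : point) :
  on_circle p -> on_circle q -> on_circle c -> on_circle d -> before p q ->
  chords_intersect p q c d <->
  ~ ((before p c /\ before c q) /\ (before p d /\ before d q) \/
     (before c p \/ before q c) /\ (before d p \/ before q d)).
Proof.
move=> Hp Hq Hc Hd Hpq.
have npq : p <> q by move=> E; move: Hpq; rewrite E => /before_irr.
rewrite chords_intersectP //.
have irr := before_irr; have tr := before_trans.
have pos x : on_circle x ->
    let I := before p x /\ before x q in let O := before x p \/ before q x in
    [\/ [/\ I, ~ O & orient p q x < 0], [/\ ~ I, O & 0 < orient p q x]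
      | [/\ ~ I, ~ O & orient p q x = 0]].
  move=> Hx I O.
  have IO : I -> O -> False by move=> [H1 H2] [H|H]; apply: irr (tr _ _ _ _ _); eassumption.
  have [H|[H|E]] := before_total Hx Hp.
  - have HO : O by left.
    by constructor 2; split=> //; [move/IO; apply | rewrite -orient_rot; apply: orient_before].
  - have [H'|[H'|E]] := before_total Hx Hq.
    + have HI : I by [].
      constructor 1; split=> //; first exact: IO.
      by have := orient_before Hp Hx Hq H H'; rewrite /orient; lra.
    + have HO : O by right.
      by constructor 2; split=> //; [move/IO; apply | apply: orient_before].
    + constructor 3; rewrite /I /O E; split; [by case=> _ /irr | | by rewrite /orient; ring].
      by case=> [/(tr _ _ _ Hpq)|] /irr.
  - constructor 3; rewrite /I /O E; split; [by case=> /irr | | by rewrite /orient; ring].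
    by case=> [/irr|/tr/(_ Hpq)/irr].
by case: (pos c Hc) => [[c1 c2 oc]|[c1 c2 oc]|[c1 c2 oc]];
  case: (pos d Hd) => [[d1 d2 od]|[d1 d2 od]|[d1 d2 od]]; split; try tauto; nra.
Qed.

Local Close Scope R_scope.

(** * Combinatorial chord models *)

Definition crossing (a b c d : nat) : bool :=
  [&& a < c, c < b & b < d] || [&& c < a, a < d & d < b].

Definition chord_model (n : nat) (adj : rel 'I_n) (l r : 'I_n -> nat) : Prop :=
  [/\ forall v, l v < r v < n.*2,
      forall u v, u <> v -> [/\ l u <> l v, l u <> r v & r u <> r v]
    & forall u v, u <> v -> adj u v = crossing (l u) (r u) (l v) (r v)].

(** Position [i] is placed at the circle point of parameter [i], which respects the cut order. *)
Lemma chord_model_circle_graph (n : nat) (adj : rel 'I_n) (l r : 'I_n -> nat) :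
  chord_model adj l r -> circle_graph adj.
Proof.
move=> [Hlr Hinj Hadj].
have lt_pt i j : before (circle_pt (INR i)) (circle_pt (INR j)) <-> i < j.
  by rewrite before_circle_pt; split=> [/INR_lt/ltP|/ltP/lt_INR].
exists (fun v => circle_pt (INR (l v))), (fun v => circle_pt (INR (r v))); split.
  move=> v; split; [exact: circle_pt_on | split; [exact: circle_pt_on |]].
  move=> E; have /lt_pt : l v < r v by case/andP: (Hlr v).
  by rewrite E => /before_irr.
move=> u v Huv.
rewrite Hadj // chords_intersect_before ?lt_pt; try exact: circle_pt_on;
  last by case/andP: (Hlr u).
have [? ? ?] := Hinj u v Huv; have [? ? ?] := Hinj v u (not_eq_sym Huv).
by have /andP[? _] := Hlr u; have /andP[? _] := Hlr v; rewrite /crossing; lia.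
Qed.

Definition rank (T : finType) (lt : rel T) (x : T) : nat := #|[set y | lt y x]|.

Lemma rank_homo (T : finType) (lt : rel T) (x y : T) :
  irreflexive lt -> transitive lt -> lt x y -> rank lt x < rank lt y.
Proof.
move=> irr tr Hxy; apply/proper_card/properP; split.
  by apply/subsetP=> z; rewrite !inE => /tr; apply.
by exists x; rewrite !inE ?irr.
Qed.

Lemma rank_mono (T : finType) (lt : rel T) (x y : T) :
  irreflexive lt -> transitive lt -> (forall x y, x <> y -> lt x y || lt y x) ->
  (rank lt x < rank lt y) = lt x y.
Proof.
move=> irr tr tot; apply/idP/idP; last exact: rank_homo.
have [-> |/eqP/tot/orP[//|/(rank_homo irr tr) H1 H2]] := eqVneq x y; first by rewrite ltnn.
by have := ltn_trans H1 H2; rewrite ltnn.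
Qed.

Lemma rank_lt_card (T : finType) (lt : rel T) (x : T) :
  irreflexive lt -> rank lt x < #|T|.
Proof.
move=> irr; rewrite -cardsT; apply/proper_card/properP; split; first exact: subsetT.
by exists x; rewrite !inE ?irr.
Qed.

Lemma before_dec (p q : point) : {before p q} + {~ before p q}.
Proof.
rewrite /before.
have [E|E] := Req_dec_T p.1 (-1); have [F|F] := Req_dec_T q.1 (-1);
  have [H|H] := Rlt_dec (slope p) (slope q); try (by left; tauto); by right; tauto.
Qed.

Definition beforeb (p q : point) : bool := if before_dec p q then true else false.

Lemma beforeP (p q : point) : reflect (before p q) (beforeb p q).
Proof. by rewrite /beforeb; case: before_dec => H; constructor. Qed.

(** The flag is [true] at the second end, so exchanging the two functions yields the opposite
    end. *)
Definition endpoint (n : nat) (T : Type) (l r : 'I_n -> T) (e : 'I_n * bool) : T :=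
  if e.2 then r e.1 else l e.1.

(* Chords with a common end intersect, so ties are broken to make them cross:
   left ends come before right ends, then ends are sorted by the opposite end. *)
Definition tie_break (n : nat) (lo hi : 'I_n -> nat) : rel ('I_n * bool) :=
  fun e f =>
  let p := endpoint lo hi e in let p' := endpoint lo hi f in
  let q := endpoint hi lo e in let q' := endpoint hi lo f in
  (p < p') || (p == p') && ((e.2 < f.2) || (e.2 == f.2) &&
  ((q < q') || (q == q') && (e.1 < f.1))).

Lemma weak_chord_model (n : nat) (adj : rel 'I_n) (lo hi : 'I_n -> nat) :
  (forall v, lo v < hi v) ->
  (forall u v, u <> v -> adj u v =
     [&& lo u <= lo v, lo v <= hi u & hi u <= hi v] ||
     [&& lo v <= lo u, lo u <= hi v & hi v <= hi u]) ->
  exists l r, chord_model adj l r.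
Proof.
move=> Hlh Hadj; set lt := tie_break lo hi.
have irr : irreflexive lt by move=> [u s]; rewrite /lt /tie_break /=; lia.
have tr : transitive lt.
  by move=> [v t] [u s] [w x]; rewrite /lt /tie_break /endpoint /=; case: s t x => [] [] []; lia.
have tot x y : x <> y -> lt x y || lt y x.
  case: x y => [u s] [v t] Hne; have : s = t -> nat_of_ord u <> v.
    by move=> E /val_inj H; apply: Hne; rewrite E H.
  by rewrite /lt /tie_break /endpoint /=; case: s t {Hne} => [] [] /=; lia.
have mono x y : (rank lt x < rank lt y) = lt x y by apply: rank_mono.
exists (fun v => rank lt (v, false)), (fun v => rank lt (v, true)); split.
- move=> v; rewrite mono {1}/lt /tie_break /endpoint /= Hlh /=.
  by rewrite (leq_trans (rank_lt_card (v, true) irr)) // card_prod card_ord card_bool muln2.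
- have ne x y : x <> y -> rank lt x <> rank lt y.
    by move/tot; rewrite -!mono; lia.
  by move=> u v Huv; split; apply: ne; case.
- move=> u v Huv; rewrite Hadj // /crossing !mono /lt /tie_break /endpoint /=.
  have : nat_of_ord u <> v by move/val_inj.
  by have := Hlh u; have := Hlh v; lia.
Qed.

(** Ends are ranked along the cut circle. Coinciding ends share a rank, hence the detour through
    [weak_chord_model], which separates them. *)
Lemma circle_graph_chord_model (n : nat) (adj : rel 'I_n) :
  circle_graph adj -> exists l r, chord_model adj l r.
Proof.
move=> [a [b [Hab Hadj]]].
pose pt := endpoint a b.
have pt_on e : on_circle (pt e) by rewrite /pt /endpoint; case: (Hab e.1) => ? [? _]; case: ifP.
pose lt e f := beforeb (pt e) (pt f).
have irr : irreflexive lt by move=> e; apply/beforeP/before_irr.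
have tr : transitive lt.
  by move=> f e g /beforeP Hef /beforeP Hfg; apply/beforeP; apply: before_trans Hfg.
have eq_rank e f : pt e = pt f -> rank lt e = rank lt f.
  by move=> E; rewrite /rank /lt E.
have ltP e f : before (pt e) (pt f) <-> rank lt e < rank lt f.
  split; first by move/beforeP; apply: rank_homo.
  have [//|[/beforeP/(rank_homo irr tr) H|/eq_rank ->]] := before_total (pt_on e) (pt_on f); lia.
have neq v : rank lt (v, false) <> rank lt (v, true).
  have [Ha [Hb Hne]] := Hab v => E.
  by have [H|[H|//]] := before_total Ha Hb;
     [have := (ltP (v, false) (v, true)).1 H | have := (ltP (v, true) (v, false)).1 H]; lia.
pose lo v := minn (rank lt (v, false)) (rank lt (v, true)).
pose hi v := maxn (rank lt (v, false)) (rank lt (v, true)).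
apply: (@weak_chord_model _ _ lo hi); first by move=> v; have := neq v; rewrite /lo /hi; lia.
move=> u v Huv.
have [Hu1 [Hu2 _]] := Hab u; have [Hv1 [Hv2 _]] := Hab v.
have swap p q c d : chords_intersect p q c d -> chords_intersect q p c d.
  move=> [t [s [Ht [Hs E]]]]; exists (Rminus R1 t), s; split; last split=> //.
    by move: Ht; rewrite /in_unit_interval; lra.
  by rewrite -E /seg_pt /=; congr pair; ring.
have {}Hadj := Hadj u v Huv.
(* The flag [s] selects the end of the chord of [u] that comes first in the cut order; [swap] makes
   the direction irrelevant. *)
have [s [Hs {}Hadj]] : exists s, before (pt (u, s)) (pt (u, ~~ s)) /\
    (adj u v <-> chords_intersect (pt (u, s)) (pt (u, ~~ s)) (a v) (b v)).
  case: (before_total Hu1 Hu2) => [H|[H|E]].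
  - by exists false.
  - by exists true; split=> //; rewrite Hadj; split; apply: swap.
  - by case: (neq u); apply: eq_rank.
have {}Hadj : adj u v <->
    ~ ((rank lt (u, s) < rank lt (v, false) /\ rank lt (v, false) < rank lt (u, ~~ s)) /\
       (rank lt (u, s) < rank lt (v, true) /\ rank lt (v, true) < rank lt (u, ~~ s)) \/
       (rank lt (v, false) < rank lt (u, s) \/ rank lt (u, ~~ s) < rank lt (v, false)) /\
       (rank lt (v, true) < rank lt (u, s) \/ rank lt (u, ~~ s) < rank lt (v, true))).
  by rewrite Hadj chords_intersect_before // -!ltP.
move: Hs => /ltP; have := neq v; move: Hadj; rewrite /lo /hi; case: s => /=.
all: case: (adj u v) => /=; lia.
Qed.

(** * Counting open chords *)

Lemma card_sum_bool (T : finType) (P : pred T) : #|[set u | P u]| = \sum_u P u.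
Proof.
rewrite cardsE -sum1_card big_mkcond; apply: eq_bigr => u _.
by rewrite unfold_in; case: (P u).
Qed.

Lemma sum_eq1 (T : finType) (v : T) : \sum_u (u == v) = 1.
Proof. by rewrite (bigD1 v) //= eqxx big1 // => u /negPf->. Qed.

Section Balance.

Variables (n : nat) (l r ol orr : 'I_n -> nat).

(** Chords open in the gap just before position [p]; the gap just after it is the one before
    [p.+1]. *)
Definition opened (p : nat) : nat := #|[set u | l u < p <= r u]|.

Definition node_balance (h : nat -> nat -> bool) (v : 'I_n) : bool :=
  h (l v) (ol v) (+) h (l v).+1 (ol v).+1 (+)
  (h (r v) (orr v).+1 (+) h (r v).+1 (orr v)).

Definition balance (h : nat -> nat -> bool) : bool :=
  (\big[addb/false]_v node_balance h v) (+) (h 0 0 (+) h n.*2 0).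

Notation pos := (endpoint l r).
Notation before_end := (endpoint ol (fun v => (orr v).+1)).
Notation after_end := (endpoint (fun v => (ol v).+1) orr).

Lemma balanceE h : balance h =
  (\big[addb/false]_e (h (pos e) (before_end e) (+) h (pos e).+1 (after_end e)))
  (+) (h 0 0 (+) h n.*2 0).
Proof.
rewrite /balance; congr addb.
pose F v s := h (pos (v, s)) (before_end (v, s)) (+) h (pos (v, s)).+1 (after_end (v, s)).
transitivity (\big[addb/false]_v \big[addb/false]_s F v s).
  by apply: eq_bigr => v _; rewrite big_bool; apply: addbC.
by rewrite pair_bigA; apply: eq_bigr => - [].
Qed.

Definition ends_distinct : Prop :=
  (forall v, l v < r v < n.*2) /\ injective pos.

Hypothesis ends : ends_distinct.

Lemma ends_neq u v : u <> v ->
  [/\ l u <> l v, l u <> r v, r u <> l v & r u <> r v].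
Proof.
case: ends => _ inj Huv.
by split=> E; [have := inj (u, false) (v, false) E | have := inj (u, false) (v, true) E
  | have := inj (u, true) (v, false) E | have := inj (u, true) (v, true) E]; case.
Qed.

Lemma opened_left v : opened (l v).+1 = (opened (l v)).+1.
Proof.
transitivity (opened (l v) + \sum_u (u == v)); last by rewrite sum_eq1 addn1.
rewrite /opened !card_sum_bool -big_split.
apply: eq_bigr => u _ /=; have := ends.1 v; have [->|/eqP/ends_neq[]] := eqVneq u v; lia.
Qed.

Lemma opened_right v : opened (r v) = (opened (r v).+1).+1.
Proof.
transitivity (opened (r v).+1 + \sum_u (u == v)); last by rewrite sum_eq1 addn1.
rewrite /opened !card_sum_bool -big_split.
apply: eq_bigr => u _ /=; have := ends.1 v; have [->|/eqP/ends_neq[]] := eqVneq u v; lia.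
Qed.

Lemma opened0 : opened 0 = 0.
Proof. by apply/eqP; rewrite cards_eq0; apply/eqP/setP=> u; rewrite !inE; lia. Qed.

Lemma opened_double : opened n.*2 = 0.
Proof.
by apply/eqP; rewrite cards_eq0; apply/eqP/setP=> u; rewrite !inE; have := ends.1 u; lia.
Qed.

(** Both sides count the chords enclosing [v] and those crossing it on either side: an enclosing
    chord or left crosser is open before [l v], an enclosing chord or right crosser after [r v]. *)
Lemma opened_lefts_rights v :
  opened (l v) + #|[set u | [&& l v < l u, l u < r v & r v < r u]]| =
  opened (r v).+1 + #|[set u | [&& l u < l v, l v < r u & r u < r v]]|.
Proof.
rewrite /opened !card_sum_bool -!big_split.
apply: eq_bigr => u _ /=; have := ends.1 v; have := ends.1 u.
by have [->|/eqP/ends_neq[]] := eqVneq u v; lia.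
Qed.

Lemma pos_bound e : pos e < n.*2.
Proof. by case: e => v []; rewrite /endpoint /=; have := ends.1 v; lia. Qed.

(** The [2n] distinct ends fill all positions below [2n], so the sum telescopes over consecutive
    gaps and cancels with the two extreme pairs. *)
Lemma balance_opened h :
  (forall v, ol v = opened (l v)) -> (forall v, orr v = opened (r v).+1) ->
  balance h = false.
Proof.
move=> Hol Hor; rewrite balanceE.
pose g p := h p (opened p) (+) h p.+1 (opened p.+1).
rewrite (eq_bigr (fun e => g (pos e))); last first.
  by move=> [v []] _; rewrite /g /endpoint /= ?Hol ?Hor ?opened_left ?opened_right.
pose f e : 'I_n.*2 := Ordinal (pos_bound e).
have bij_f : bijective f.
  apply: inj_card_bij; first by move=> x y /(congr1 val) /= /ends.2.
  by rewrite card_prod !card_ord card_bool muln2.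
have -> : \big[addb/false]_e g (pos e) = \big[addb/false]_(i < n.*2) g i.
  by rewrite (reindex f) //; apply: onW_bij.
suff H m : \big[addb/false]_(i < m) g i = h 0 (opened 0) (+) h m (opened m).
  by rewrite H opened0 opened_double addbb.
elim: m => [|m IH]; first by rewrite big_ord0 addbb.
by rewrite big_ord_recr /= IH /g addbA -(addbA (h 0 _)) addbb addbF.
Qed.

End Balance.

(** For the test function [x <= p], an end contributes exactly when it sits at [p], and the extreme
    pairs contribute 1. Hence every position is occupied, and [2n] ends covering [2n] positions are
    distinct and in range. *)
Lemma balanced_ends_distinct (n : nat) (l r ol orr : 'I_n -> nat) :
  (forall v, l v < r v) -> (forall h, balance l r ol orr h = false) -> ends_distinct l r.
Proof.
move=> Hlr bal.
have surj (p : 'I_n.*2) : exists e, endpoint l r e = p.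
  have := bal (fun x _ => x <= p); rewrite balanceE.
  have [/existsP[e /eqP]|/existsPn none] := boolP [exists e, endpoint l r e == p].
    by exists e.
  rewrite big1; first by have := ltn_ord p; lia.
  by move=> e _; have := none e; lia.
have pick_end (p : 'I_n.*2) : {e | endpoint l r e == p}.
  by apply: sigW; have [e E] := surj p; exists e; apply/eqP.
pose g p := sval (pick_end p).
have gP p : endpoint l r (g p) = p by rewrite /g; case: (pick_end p) => e /= /eqP.
have inj_g : injective g by move=> p q E; apply: val_inj; rewrite /= -(gP p) -(gP q) E.
have [g' _ g'K] : bijective g.
  by apply: inj_card_bij => //; rewrite card_prod !card_ord card_bool muln2.
have posE e : endpoint l r e = g' e by rewrite -{1}(g'K e) gP.
split; last by move=> x y; rewrite !posE => /val_inj /(congr1 g); rewrite !g'K.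
by move=> v; rewrite Hlr (_ : r v = g' (v, true)) ?ltn_ord // -posE.
Qed.

(** Induction on the position [p], with a test function true at the correct pairs up to [p]. Earlier
    ends contribute twice and cancel, later ones nothing, the extreme pairs 1; so the pair before
    the end at [p] must be correct. *)
Lemma balanced_opened (n : nat) (l r ol orr : 'I_n -> nat) :
  ends_distinct l r -> (forall h, balance l r ol orr h = false) ->
  (forall v, ol v = opened l r (l v)) /\ (forall v, orr v = opened l r (r v).+1).
Proof.
move=> ends bal; set O := opened l r.
pose A := endpoint ol (fun v => (orr v).+1); pose B := endpoint (fun v => (ol v).+1) orr.
have AB e : A e = O (endpoint l r e) -> B e = O (endpoint l r e).+1.
  case: e => v []; rewrite /A /B /endpoint /O /=; first by rewrite opened_right // => -[].
  by rewrite opened_left // => ->.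
suff H p e : endpoint l r e = p -> A e = O p.
  split=> v; first exact: (H _ (v, false)).
  by rewrite -(AB (v, true)) //; apply: H.
elim/ltn_ind: p e => p IH e Ep.
have Hp : p < n.*2 by rewrite -Ep pos_bound.
have := bal (fun x o => (x <= p) && (o == O x)).
rewrite balanceE (bigD1 e) //= big1 => [|f /eqP fe].
  rewrite -/(A e) -/(B e) Ep leqnn ltnn addbF /O opened0 // eqxx leqNgt Hp.
  by case: eqP.
rewrite -/(A f) -/(B f); have [Hlt|Hgt|E] := ltngtP (endpoint l r f) p.
- have Af := IH _ Hlt f erefl.
  by rewrite Af (AB _ Af) !eqxx.
- by [].
- by case: fe; apply: ends.2; rewrite Ep E.
Qed.

(* A missing crossing pair is a missing right neighbour of one of its chords and
   a missing left neighbour of the other; the leftmost chord with a missing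
   neighbour would only miss right ones. *)
Lemma balanced_chord_model (n : nat) (adj : rel 'I_n) (l r ol orr : 'I_n -> nat) :
  (forall u v, adj u v = adj v u) ->
  (forall v, l v < r v) -> (forall h, balance l r ol orr h = false) ->
  (forall v u, adj v u -> crossing (l v) (r v) (l u) (r u)) ->
  (forall v, #|[set u | adj v u && (l v < l u)]| + ol v =
             #|[set u | adj v u && (l u < l v)]| + orr v) ->
  chord_model adj l r.
Proof.
move=> sym Hlr bal Hcross Hcount.
have ends := balanced_ends_distinct Hlr bal.
have [Eol Eor] := balanced_opened ends bal.
pose rt v := [set u | [&& l v < l u, l u < r v & r v < r u]].
pose lt v := [set u | [&& l u < l v, l v < r u & r u < r v]].
have subR v : [set u | adj v u && (l v < l u)] \subset rt v.
  by apply/subsetP=> u; rewrite !inE => /andP[/Hcross]; rewrite /crossing; lia.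
have subL v : [set u | adj v u && (l u < l v)] \subset lt v.
  by apply/subsetP=> u; rewrite !inE => /andP[/Hcross]; rewrite /crossing; lia.
have complete p v u : l v < p -> u \in rt v -> adj v u.
  elim: p v u => // p IH v u Hv Hu.
  (* A left crosser of [v] starts earlier, so by induction it already has [v] as a neighbour. With
     the left side complete, equal counts then settle the right side. *)
  have HL : [set u | adj v u && (l u < l v)] = lt v.
    apply/eqP; rewrite eqEsubset subL; apply/subsetP => w; rewrite !inE => Hw.
    have Hwv : l w < l v by case/andP: Hw.
    by rewrite Hwv andbT sym; apply: IH; [lia | rewrite inE; lia].
  have HR : [set u | adj v u && (l v < l u)] = rt v.
    apply/eqP; rewrite eqEcard subR.
    have := opened_lefts_rights (l := l) (r := r) ends v; rewrite -/(rt v) -/(lt v) -HL -Eol -Eor.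
    by have := Hcount v; lia.
  by move: Hu; rewrite -HR inE => /andP[].
split; first exact: ends.1.
  by move=> u v /(ends_neq ends)[].
move=> u v Huv; apply/idP/idP => [/Hcross//|].
by case/orP=> H; [| rewrite sym]; apply: (complete (l _).+1 _ _ (ltnSn _)); rewrite inE; lia.
Qed.

Lemma chord_model_ends_distinct (n : nat) (adj : rel 'I_n) (l r : 'I_n -> nat) :
  chord_model adj l r -> ends_distinct l r.
Proof.
move=> [Hlr Hinj _]; split=> // -[u s] [v t]; rewrite /endpoint /=.
have [<-|/eqP Huv] := eqVneq u v; first by have := Hlr u; case: s t => [] [] //; lia.
have := Hinj u v Huv; have := Hinj v u (not_eq_sym Huv).
by case: s t => [] [] [? ? ?] [? ? ?] E; exfalso; lia.
Qed.

Lemma chord_model_count (n : nat) (adj : rel 'I_n) (l r : 'I_n -> nat) (v : 'I_n) :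
  chord_model adj l r ->
  #|[set u | adj v u && (l v < l u)]| + opened l r (l v) =
  #|[set u | adj v u && (l u < l v)]| + opened l r (r v).+1.
Proof.
move=> model; have ends := chord_model_ends_distinct model; have [Hlr _ Hadj] := model.
have := opened_lefts_rights ends v.
rewrite ![_ + opened _ _ _]addnC.
have -> : [set u | [&& l v < l u, l u < r v & r v < r u]] = [set u | adj v u && (l v < l u)].
  apply/setP=> u; rewrite !inE; have [->|/eqP Huv] := eqVneq u v; first by rewrite ltnn andbF.
  by rewrite Hadj; [rewrite /crossing; lia | exact: not_eq_sym].
suff -> : [set u | [&& l u < l v, l v < r u & r u < r v]] = [set u | adj v u && (l u < l v)].
  by [].
apply/setP=> u; rewrite !inE; have [->|/eqP Huv] := eqVneq u v; first by rewrite ltnn andbF.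
by rewrite Hadj; [rewrite /crossing; lia | exact: not_eq_sym].
Qed.

(** * Spanning trees and local checks *)

(** [d] is the length of a shortest walk from the root, and the parent is the last but one vertex of
    such a walk. *)
Lemma spanning_tree (T : finType) (e : rel T) (root : T) :
  (forall v, connect e root v) ->
  exists (p : T -> T) (d : T -> nat), forall v, v != root -> e (p v) v /\ d (p v) < d v.
Proof.
move=> conn.
have walk v : exists k, [exists p : k.-tuple T, path e root p && (last root p == v)].
  have /connectP[p Hp ->] := conn v; exists (size p); apply/existsP; exists (in_tuple p).
  by rewrite Hp eqxx.
pose d v := ex_minn (walk v).
have step v : exists u, v != root -> e u v /\ d u < d v.
  have [->|Hv] := eqVneq v root; first by exists root.
  rewrite {2}/d; case: ex_minnP => k /existsP[[p /= /eqP Hk]] /andP[].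
  case/lastP: p Hk => [|p u] Hk; first by move=> _ /= /eqP E; rewrite E eqxx in Hv.
  rewrite rcons_path last_rcons => /andP[Hp Hl] /eqP <- _.
  exists (last root p) => _; split=> //.
  rewrite /d; case: ex_minnP => m _ /(_ (size p)).
  rewrite -Hk size_rcons ltnS; apply; apply/existsP; exists (in_tuple p).
  by rewrite Hp eqxx.
have pick v : {u | (v != root) ==> (e u v && (d u < d v))}.
  apply: sigW; have [u Hu] := step v; exists u; apply/implyP => /Hu[-> ->] //.
by exists (fun v => sval (pick v)), d => v Hv; case: (pick v) => u /= /implyP/(_ Hv)/andP.
Qed.

Section Aggregate.

Variables (T : finType) (R : Type) (idx : R) (op : R -> R -> R) (child : rel T) (x : T -> R).

Fixpoint aggregate (k : nat) (v : T) : R :=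
  if k is k'.+1 then op (x v) (\big[op/idx]_(u | child v u) aggregate k' u) else idx.

(** Since [d] increases towards the children and stays below [k], the recursion from [u] ends within
    [k - d u] levels, and extra depth changes nothing. *)
Lemma aggregateE (d : T -> nat) (k : nat) (v : T) :
  (forall v u, child v u -> d v < d u) -> (forall v, d v < k) ->
  aggregate k v = op (x v) (\big[op/idx]_(u | child v u) aggregate k u).
Proof.
move=> Hd Hk.
suff stable m u : k <= m + d u -> aggregate m.+1 u = aggregate m u.
  by rewrite -[LHS]stable ?leq_addr.
elim: m u => [|m IH] u Hm; first by have := Hk u; lia.
have -> : aggregate m.+2 u = op (x u) (\big[op/idx]_(w | child u w) aggregate m.+1 w) by [].
have -> : aggregate m.+1 u = op (x u) (\big[op/idx]_(w | child u w) aggregate m w) by [].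
by congr op; apply: eq_bigr => w /Hd Hw; apply: IH; lia.
Qed.

End Aggregate.

(* Summed over all nodes, the equation [X v = x v + sum of X over the children
   of v] leaves X at the root equal to the total of x; no acyclicity is needed. *)
Lemma big_children (R : Type) (idx : R) (op : Monoid.com_law idx) (n : nat)
    (adj : rel 'I_n) (id par : 'I_n -> nat) (X : 'I_n -> R) :
  symmetric adj -> injective id -> (forall v, 0 < id v) ->
  (forall v, par v != 0 -> exists2 u, adj v u & id u = par v) ->
  \big[op/idx]_v \big[op/idx]_(u | adj v u && (par u == id v)) X u =
  \big[op/idx]_(u | par u != 0) X u.
Proof.
move=> sym inj pos Hpar.
under eq_bigr => v _ do rewrite big_mkcond.
(* A node with a parent is counted once, at that parent; a root is never counted, as identifiers are
   positive. *)
rewrite exchange_big [RHS]big_mkcond; apply: eq_bigr => u _ /=.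
case: eqP => [E|/eqP/Hpar[w Huw Ew]] /=.
  by rewrite big1 // => v _; rewrite E; case: eqP (pos v) => [<-|]; rewrite ?andbF.
rewrite (bigD1 w) //= sym Huw Ew eqxx big1 ?Monoid.mulm1 // => v Hv.
by rewrite -Ew (inj_eq inj) eq_sym (negPf Hv) andbF.
Qed.

Section LocalCheck.

Variables (N : nat) (V : Type) (vid rid par sz l r ol orr : V -> nat).

(* A node holds its identifier [vid], the identifiers [rid] of the root and
   [par] of its parent ([0] at the root, identifiers being positive), the size
   [sz] of its subtree, the ends [l < r] of its chord, and the numbers [ol] and
   [orr] of chords that are open just before [l] and just after [r]. *)
Definition local_check (m : V) (ms : seq V) : bool :=
  [&& all (fun m' => rid m' == rid m) ms,
      if par m == 0 then vid m == rid m else has (fun m' => vid m' == par m) ms,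
      sz m == (\sum_(m' <- ms | par m' == vid m) sz m').+1,
      l m < r m,
      [&& r m < N.*2, ol m < N.*2 & orr m < N.*2],
      all (fun m' => crossing (l m) (r m) (l m') (r m')) ms
    & count (fun m' => l m < l m') ms + ol m == count (fun m' => l m' < l m) ms + orr m].

(* The root, where [sz = n], contributes the two extreme pairs, so that the sum
   over all nodes is [balance h]. *)
Definition fingerprint (h : nat -> nat -> bool) (m : V) : bool :=
  h (l m) (ol m) (+) h (l m).+1 (ol m).+1 (+)
  (h (r m) (orr m).+1 (+) h (r m).+1 (orr m)) (+)
  (if par m == 0 then h 0 0 (+) h (sz m).*2 0 else false).

Definition fingerprint_check (h : nat -> nat -> bool) (X : V -> bool)
    (m : V) (ms : seq V) : bool :=
  (X m == fingerprint h m (+) \big[addb/false]_(m' <- ms | par m' == vid m) X m') &&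
  ((par m == 0) ==> ~~ X m).

End LocalCheck.

Lemma count_nbrs (n : nat) (adj : rel 'I_n) (v : 'I_n) (P : pred 'I_n) :
  count P (enum (adj v)) = #|[set u | adj v u && P u]|.
Proof.
rewrite -size_filter cardE; apply/perm_size/uniq_perm;
  [exact/filter_uniq/enum_uniq | exact: enum_uniq |].
by move=> u; rewrite mem_filter !mem_enum inE andbC.
Qed.

Section Network.

Variables (N n : nat) (adj : rel 'I_n) (id : 'I_n -> nat).
Hypotheses (n_gt0 : 0 < n) (sym : symmetric adj) (conn : connected_graph adj).
Hypotheses (id_inj : injective id) (id_gt0 : forall v, 0 < id v).

Section Soundness.

Variables rid par sz l r ol orr : 'I_n -> nat.
Hypothesis check : forall v,
  local_check N id rid par sz l r ol orr v (enum (adj v)).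

Lemma check_parent v : par v != 0 -> exists2 u, adj v u & id u = par v.
Proof.
have /and3P[_ H _] := check v; move: H; case: ifP => // _ /hasP[u Hu /eqP E] _.
by exists u => //; move: Hu; rewrite mem_enum.
Qed.

(** [rid] is constant by connectivity, and a root carries it as its own identifier. *)
Lemma check_root_unique u v : par u = 0 -> par v = 0 -> u = v.
Proof.
have step x y : adj x y -> rid x = rid y.
  move=> Hxy; have /andP[/allP H _] := check x.
  by have /eqP-> : rid y == rid x by apply: H; rewrite mem_enum.
have ridE x y : rid x = rid y.
  have /connectP[p Hp ->] := conn x y.
  by elim: p x Hp => //= z p IH x /andP[/step-> /IH].
have root x : par x = 0 -> id x = rid x.
  by move=> E; have /and3P[_ + _] := check x; rewrite E eqxx => /eqP.
by move=> /root Eu /root Ev; apply: id_inj; rewrite Eu Ev.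
Qed.

(** The sum over non-roots stays on both sides because a commutative monoid need not cancel; it is
    cancelled in the two uses, subtree sizes and parities. *)
Lemma root_total (R : Type) (idx : R) (op : Monoid.com_law idx) (x X : 'I_n -> R) root :
  (forall v, X v = op (x v) (\big[op/idx]_(u <- enum (adj v) | par u == id v) X u)) ->
  par root = 0 ->
  op (X root) (\big[op/idx]_(u | par u != 0) X u) =
  op (\big[op/idx]_v x v) (\big[op/idx]_(u | par u != 0) X u).
Proof.
move=> HX Hroot.
transitivity (\big[op/idx]_v X v).
  rewrite [RHS](bigD1 root) //=; congr (op _ _); apply: eq_bigl => u.
  by congr negb; apply/eqP/eqP => [E|->] //; apply: check_root_unique.
rewrite -[in RHS](big_children op X sym id_inj id_gt0 check_parent) -big_split /=.
by apply: eq_bigr => v _; rewrite [LHS]HX big_enum_cond.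
Qed.

(** Without a root every node would be counted as a child, and the sum of the sizes would exceed
    itself by [n]. *)
Lemma check_root : exists2 root, par root = 0 & sz root = n.
Proof.
have [/existsP[root /eqP Hroot]|/existsPn none] := boolP [exists v, par v == 0]; last first.
  have : \sum_v sz v = \sum_(v : 'I_n) 1 + \sum_(u | par u != 0) sz u.
    rewrite -[in RHS](big_children addn sz sym id_inj id_gt0 check_parent) -big_split /=.
    by apply: eq_bigr => v _; have /and4P[_ _ /eqP-> _] := check v; rewrite big_enum_cond.
  rewrite [X in _ = _ + X](eq_bigl xpredT) => [|u]; last by rewrite none.
  by rewrite sum_nat_const card_ord; lia.
exists root => //.
have := @root_total _ _ addn (fun=> 1) sz root.
rewrite sum_nat_const card_ord muln1 => /(_ _ Hroot)/addIn; apply=> v.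
by have /and4P[_ _ /eqP-> _] := check v.
Qed.

Lemma fingerprint_balance (h : nat -> nat -> bool) :
  \big[addb/false]_v fingerprint par sz l r ol orr h v = balance l r ol orr h.
Proof.
have [root Hroot sz_root] := check_root.
rewrite /fingerprint big_split /= -/(node_balance _ _ _ _ _ _); congr addb.
rewrite (bigD1 root) //= Hroot eqxx sz_root big1 ?addbF // => v Hv.
by case: eqP => // E; rewrite (check_root_unique E Hroot) eqxx in Hv.
Qed.

Lemma fingerprint_check_sound (h : nat -> nat -> bool) (X : 'I_n -> bool) :
  (forall v, fingerprint_check id par sz l r ol orr h X v (enum (adj v))) ->
  balance l r ol orr h = false.
Proof.
move=> HX; have [root Hroot _] := check_root.
rewrite -fingerprint_balance.
have := @root_total _ _ addb (fingerprint par sz l r ol orr h) X root.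
move=> /(_ _ Hroot)/addIb <-; first by have /andP[_] := HX root; rewrite Hroot => /negbTE.
by move=> v; have /andP[/eqP] := HX v.
Qed.

Lemma local_check_sound :
  (forall h, balance l r ol orr h = false) -> chord_model adj l r.
Proof.
move=> bal; apply: (@balanced_chord_model _ _ _ _ ol orr) => //.
- by move=> v; have /and4P[_ _ _ /andP[]] := check v.
- move=> v u Hvu; have /and5P[_ _ _ _ /and3P[_ /allP H _]] := check v.
  by apply: H; rewrite mem_enum.
- move=> v; have /and5P[_ _ _ _ /and3P[_ _ /eqP]] := check v.
  by rewrite !count_nbrs.
Qed.

End Soundness.

Lemma honest_labels (l r : 'I_n -> nat) :
  n <= N -> (forall v, adj v v = false) -> chord_model adj l r ->
  exists (root : 'I_n) (par sz : 'I_n -> nat) (X : (nat -> nat -> bool) -> 'I_n -> bool),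
  let ol v := opened l r (l v) in let orr v := opened l r (r v).+1 in
  [/\ forall v, par v = 0 \/ exists u, par v = id u,
      forall v, sz v <= n,
      forall v, local_check N id (fun=> id root) par sz l r ol orr v (enum (adj v))
    & forall h v, fingerprint_check id par sz l r ol orr h (X h) v (enum (adj v))].
Proof.
move=> nN irr model.
have [p [d Hpd]] := spanning_tree (conn (Ordinal n_gt0)).
set root := Ordinal n_gt0 in Hpd *.
pose par v := if v == root then 0 else id (p v).
pose child v u := adj v u && (par u == id v).
have Hchild v u : child v u -> d v < d u.
  rewrite /child /par; case: (eqVneq u root) => [_|/Hpd[_ Hd]]; first by have := id_gt0 v; lia.
  by case/andP=> _ /eqP/id_inj <-.
pose k := (\max_v d v).+1.
have Hk v : d v < k by rewrite ltnS; apply: leq_bigmax.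
pose sz := aggregate 0 addn child (fun=> 1) k.
have szE v : sz v = (\sum_(u <- enum (adj v) | par u == id v) sz u).+1.
  by rewrite /sz (aggregateE _ _ _ _ Hchild Hk) big_enum_cond.
have sz_child v u : child v u -> sz u <= sz v.
  by move=> H; rewrite (szE v) big_enum_cond (bigD1 u) //=; lia.
pose ol v := opened l r (l v); pose orr v := opened l r (r v).+1.
pose X h := aggregate false addb child (fingerprint par sz l r ol orr h) k.
have ends := chord_model_ends_distinct model.
have bound v : opened l r v <= n by rewrite -[n in _ <= n]card_ord; apply: max_card.
have Hcheck v : local_check N id (fun=> id root) par sz l r ol orr v (enum (adj v)).
  have Hlr := ends.1 v.
  apply/and5P; split; first by apply/allP.
  - rewrite /par; case: (eqVneq v root) => [->|/Hpd[Hadj _]]; first by rewrite !eqxx.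
    have -> : (id (p v) == 0) = false by have := id_gt0 (p v); lia.
    by apply/hasP; exists (p v); rewrite // mem_enum unfold_in sym.
  - by rewrite -szE.
  - by case/andP: Hlr.
  apply/and3P; split.
  - by have := bound (l v); have := bound (r v).+1; rewrite /ol /orr; lia.
  - apply/allP=> u; rewrite mem_enum unfold_in => Hvu; case: (model) => _ _ <- // E.
    by rewrite E irr in Hvu.
  - by rewrite !count_nbrs (chord_model_count v model).
(* The soundness lemma applied to the honest labels gives size [n] at the root; sizes only grow
   towards it, which bounds them all. *)
have [root' Hroot' sz_root] := check_root Hcheck.
have par0 v : par v = 0 -> v = root by rewrite /par; case: eqP => // _; have := id_gt0 (p v); lia.
exists root, par, sz, X; split => //.
- by move=> v; rewrite /par; case: eqP; [left | right; exists (p v)].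
- move=> v; rewrite -[X in _ <= X]sz_root (par0 _ Hroot').
  elim/ltn_ind: {v}(d v) {-2}v (erefl (d v)) => m IH v Em.
  have [->//|Hv] := eqVneq v root.
  have [Hadj Hd] := Hpd v Hv.
  apply: leq_trans (IH _ _ (p v) erefl); last by rewrite -Em.
  by apply: sz_child; rewrite /child Hadj /par (negPf Hv) eqxx.
- move=> h v; have HX u : X h u = fingerprint par sz l r ol orr h u (+)
      \big[addb/false]_(w <- enum (adj u) | par w == id u) X h w.
    by rewrite {1}/X (aggregateE _ _ _ _ Hchild Hk) big_enum_cond.
  rewrite /fingerprint_check -HX eqxx; apply/implyP=> /eqP Hv.
  have := root_total Hcheck HX Hv => /addIb ->.
  by rewrite (fingerprint_balance Hcheck) (balance_opened ends).
Qed.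
End Network.

(** * Encoding of certificates and messages *)

(** A node sees only the multiset of received messages, so its checks must not depend on their
    order. *)
Lemma local_check_perm (N : nat) (V : eqType) (vid rid par sz l r ol orr : V -> nat)
    (m : V) (s t : seq V) : perm_eq s t ->
  local_check N vid rid par sz l r ol orr m s = local_check N vid rid par sz l r ol orr m t.
Proof.
move=> E; rewrite /local_check !(perm_all _ E) (perm_has _ E) (perm_big _ E).
by rewrite !(permP E).
Qed.

Lemma fingerprint_check_perm (V : eqType) (vid par sz l r ol orr : V -> nat)
    (h : nat -> nat -> bool) (X : V -> bool) (m : V) (s t : seq V) : perm_eq s t ->
  fingerprint_check vid par sz l r ol orr h X m s =
  fingerprint_check vid par sz l r ol orr h X m t.
Proof. by move=> E; rewrite /fingerprint_check (perm_big _ E). Qed.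

Lemma local_check_map (N : nat) (V V' : Type) (f : V' -> V)
    (vid rid par sz l r ol orr : V -> nat) (vid' rid' par' sz' l' r' ol' orr' : V' -> nat)
    (m : V') (s : seq V') :
  (forall x, vid (f x) = vid' x) -> (forall x, rid (f x) = rid' x) ->
  (forall x, par (f x) = par' x) -> (forall x, sz (f x) = sz' x) ->
  (forall x, l (f x) = l' x) -> (forall x, r (f x) = r' x) ->
  (forall x, ol (f x) = ol' x) -> (forall x, orr (f x) = orr' x) ->
  local_check N vid rid par sz l r ol orr (f m) [seq f x | x <- s] =
  local_check N vid' rid' par' sz' l' r' ol' orr' m s.
Proof.
move=> E0 E1 E2 E3 E4 E5 E6 E7.
rewrite /local_check !all_map has_map big_map !count_map E0 E1 E2 E3 E4 E5 E6 E7.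
congr [&& _, _, _, _, _, _ & _].
- by apply: eq_all => x; rewrite /= E1.
- by case: ifP => // _; apply: eq_has => x; rewrite /= E0.
- by congr (_ == _.+1); apply: eq_big => x //; rewrite E2.
- by apply: eq_all => x; rewrite /= E4 E5.
- by congr (_ + _ == _ + _); apply: eq_count => x; rewrite /= E4.
Qed.

Lemma fingerprint_check_map (V V' : Type) (f : V' -> V)
    (vid par sz l r ol orr : V -> nat) (vid' par' sz' l' r' ol' orr' : V' -> nat)
    (h : nat -> nat -> bool) (X : V -> bool) (X' : V' -> bool) (m : V') (s : seq V') :
  (forall x, vid (f x) = vid' x) ->
  (forall x, par (f x) = par' x) -> (forall x, sz (f x) = sz' x) ->
  (forall x, l (f x) = l' x) -> (forall x, r (f x) = r' x) ->
  (forall x, ol (f x) = ol' x) -> (forall x, orr (f x) = orr' x) -> (forall x, X (f x) = X' x) ->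
  fingerprint_check vid par sz l r ol orr h X (f m) [seq f x | x <- s] =
  fingerprint_check vid' par' sz' l' r' ol' orr' h X' m s.
Proof.
move=> E0 E2 E3 E4 E5 E6 E7 EX.
rewrite /fingerprint_check /fingerprint big_map E0 E2 E3 E4 E5 E6 E7 EX.
by congr ((_ == _ (+) _) && _); apply: eq_big => x //; rewrite E2.
Qed.

(** Lists the multiset [recv] by running through all strings of length [B]; messages of another
    length are lost. *)
Definition received (B : nat) (recv : bits -> nat) : seq bits :=
  flatten [seq nseq (recv (val m)) (val m) | m : B.-tuple bool].

Lemma received_perm (n : nat) (adj : rel 'I_n) (v : 'I_n) (B : nat) (m : 'I_n -> bits) :
  (forall u, size (m u) = B) ->
  perm_eq (received B (fun x => #|[set u | adj v u && (m u == x)]|))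
          [seq m u | u <- enum (adj v)].
Proof.
move=> Hm; apply/allP=> x _; rewrite /= count_map count_nbrs count_flatten -map_comp.
rewrite sumnE big_map big_enum /=.
under eq_bigr => t _ do rewrite count_nseq /=.
have [Hx|Hx] := eqVneq (size x) B.
  rewrite (bigD1 (Tuple (introT eqP Hx))) //= eqxx mul1n big1 ?addn0 // => t Ht.
  by move: Ht; rewrite -val_eqE /= => /negPf ->.
rewrite big1 => [|t _]; last first.
  have [E|//] := eqVneq (tval t) x.
  by rewrite -E size_tuple eqxx in Hx.
rewrite eq_sym cards_eq0; apply/eqP/setP => u; rewrite !inE /=.
have [E|//] := eqVneq (m u) x; last by rewrite andbF.
by rewrite -E Hm eqxx in Hx.
Qed.

Fixpoint bits_of (w x : nat) : bits :=
  if w is w'.+1 then odd x :: bits_of w' x./2 else [::].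

Definition nat_of_bits (s : bits) : nat := foldr (fun (b : bool) a => b + a.*2) 0 s.

Lemma size_bits_of (w x : nat) : size (bits_of w x) = w.
Proof. by elim: w x => //= w IH x; rewrite IH. Qed.

Lemma bits_ofK (w x : nat) : x < 2 ^ w -> nat_of_bits (bits_of w x) = x.
Proof.
elim: w x => [|w IH] x /=; first by rewrite expn0; lia.
by rewrite expnS => Hx; rewrite IH ?odd_double_half //; lia.
Qed.

Definition field (w i : nat) (s : bits) : nat := nat_of_bits (take w (drop (i * w) s)).

Definition encode (w : nat) (xs : seq nat) : bits := flatten [seq bits_of w x | x <- xs].

Lemma size_encode (w : nat) (xs : seq nat) : size (encode w xs) = size xs * w.
Proof. by elim: xs => //= x xs IH; rewrite size_cat size_bits_of IH mulSn. Qed.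

Lemma field0_cat (w x : nat) (s : bits) : x < 2 ^ w -> field w 0 (bits_of w x ++ s) = x.
Proof. by move=> Hx; rewrite /field drop0 take_size_cat ?size_bits_of ?bits_ofK. Qed.

Lemma fieldS_cat (w i x : nat) (s : bits) : field w i.+1 (bits_of w x ++ s) = field w i s.
Proof.
by rewrite /field drop_cat size_bits_of mulSn ltnNge leq_addr /= addKn.
Qed.

Lemma field_catl (w i : nat) (s t : bits) :
  i.+1 * w <= size s -> field w i (s ++ t) = field w i s.
Proof.
move=> H; rewrite /field drop_cat; case: ltnP => H'; last first.
  have -> : w = 0 by move: H H'; rewrite mulSn; lia.
  by rewrite !take0.
by rewrite takel_cat // size_drop; move: H; rewrite mulSn; lia.
Qed.

Lemma field_encode (w i : nat) (xs : seq nat) :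
  i < size xs -> all (fun x => x < 2 ^ w) xs -> field w i (encode w xs) = nth 0 xs i.
Proof.
elim: xs i => [|x xs IH] [|i] //= Hi /andP[Hx Hxs]; first exact: field0_cat.
by rewrite fieldS_cat; apply: IH.
Qed.

Section Protocol.

Variable c0 : nat.

(** Enough bits for identifiers, at most [n ^ c0 <= N ^ c0], and, thanks to the extra bit, for
    numbers up to [2 N]; it is computable from [N] alone. *)
Definition width (N : nat) : nat := (c0 * (trunc_log 2 N).+1).+1.

(* Two independent random Boolean functions on pairs of integers up to [2 N]. *)
Definition hash (N : nat) (r : bits) (j x o : nat) : bool :=
  nth false r ((j * N.*2.+1 + x) * N.*2.+1 + o).

Definition message (N i : nat) (r c1 c2 : bits) : bits :=
  bits_of (width N) i ++ take (7 * width N) c1 ++ take 2 c2.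

(** Each node tests its own certificate sizes: when all nodes accept, every message has length
    [8 * w + 2] and [received] misses none. *)
Definition decide (N i : nat) (r c1 c2 : bits) (recv : bits -> nat) : bool :=
  let w := width N in
  let m := message N i r c1 c2 in
  let ms := received (8 * w + 2) recv in
  let fp j := fingerprint_check (field w 0) (field w 2) (field w 3) (field w 4) (field w 5)
    (field w 6) (field w 7) (hash N r j) (fun s => nth false s (8 * w + j)) m ms in
  [&& size c1 == 7 * w, size c2 == 2,
      local_check N (field w 0) (field w 1) (field w 2) (field w 3) (field w 4) (field w 5)
        (field w 6) (field w 7) m ms,
      fp 0 & fp 1].

Definition circle_protocol : protocol :=
  Protocol (fun N => 2 * (N.*2.+1 * N.*2.+1)) message decide.

Lemma all_acceptP (N n : nat) (adj : rel 'I_n) (id : 'I_n -> nat)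
    (c1 c2 : 'I_n -> bits) (r : bits) (w := width N) (f := fun i v => field w i (c1 v)) :
  (forall v, id v < 2 ^ w) ->
  reflect
    ((forall v, size (c1 v) = 7 * w /\ size (c2 v) = 2) /\
     (forall v, local_check N id (f 0) (f 1) (f 2) (f 3) (f 4) (f 5) (f 6) v (enum (adj v))) /\
     (forall j, j < 2 -> forall v, fingerprint_check id (f 1) (f 2) (f 3) (f 4) (f 5) (f 6)
        (hash N r j) (fun v => nth false (c2 v) j) v (enum (adj v))))
    (all_accept circle_protocol N adj id c1 c2 r).
Proof.
move=> Hid; pose M u := message N (id u) r (c1 u) (c2 u).
have main : (forall v, size (c1 v) = 7 * w /\ size (c2 v) = 2) ->
  all_accept circle_protocol N adj id c1 c2 r =
  [forall v, [&& local_check N id (f 0) (f 1) (f 2) (f 3) (f 4) (f 5) (f 6) v (enum (adj v)),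
   fingerprint_check id (f 1) (f 2) (f 3) (f 4) (f 5) (f 6)
        (hash N r 0) (fun v => nth false (c2 v) 0) v (enum (adj v)) &
   fingerprint_check id (f 1) (f 2) (f 3) (f 4) (f 5) (f 6)
        (hash N r 1) (fun v => nth false (c2 v) 1) v (enum (adj v))]].
  move=> Hsize.
  have ME u : M u = bits_of w (id u) ++ c1 u ++ c2 u.
    by have [S1 S2] := Hsize u; rewrite /M /message -/w -{1}S1 -{1}S2 !take_size.
  have sizeM u : size (M u) = 8 * w + 2.
    by have [S1 S2] := Hsize u; rewrite ME !size_cat size_bits_of S1 S2; lia.
  have F0 u : field w 0 (M u) = id u by rewrite ME field0_cat.
  have FS i : i < 7 -> forall u, field w i.+1 (M u) = f i u.
    move=> Hi u; rewrite ME fieldS_cat field_catl //.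
    by have [-> _] := Hsize u; rewrite leq_mul2r Hi orbT.
  have FX j : j < 2 -> forall u, nth false (M u) (8 * w + j) = nth false (c2 u) j.
    move=> Hj u; have [S1 S2] := Hsize u.
    rewrite ME nth_cat size_bits_of nth_cat S1.
    have -> : 8 * w + j < w = false by lia.
    have -> : 8 * w + j - w < 7 * w = false by lia.
    by congr nth; lia.
  apply: eq_forallb => v; rewrite /= /decide -/w -/(M v).
  have [-> ->] := Hsize v; rewrite !eqxx /=.
  have P := received_perm adj v sizeM.
  rewrite (local_check_perm _ _ _ _ _ _ _ _ _ _ P).
  rewrite !(fingerprint_check_perm _ _ _ _ _ _ _ _ _ _ P).
  congr [&& _, _ & _]; first by apply: local_check_map; auto.
    by apply: fingerprint_check_map; auto.
  by apply: fingerprint_check_map; auto.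
apply: (iffP idP) => [Hacc|[Hsize [Hloc Hfp]]]; last first.
  by rewrite main //; apply/forallP => v; rewrite Hloc !Hfp.
have Hsize v : size (c1 v) = 7 * w /\ size (c2 v) = 2.
  by move/forallP/(_ v): Hacc => /and3P[/eqP-> /eqP->].
move: Hacc; rewrite main // => /forallP H; split; last split; rewrite //.
- by move=> v; case/andP: (H v).
- by move=> [|[|//]] _ v; case/and3P: (H v).
Qed.

End Protocol.

(** * Completeness and soundness *)

(** The images of [A] are disjoint and lie in its complement, which is therefore at least twice as
    large as [A]. *)
Lemma two_disjoint_copies (T : finType) (A : {set T}) (g0 g1 : T -> T) :
  injective g0 -> injective g1 ->
  (forall x, x \in A -> g0 x \notin A /\ g1 x \notin A) ->
  (forall x y, x \in A -> y \in A -> g0 x <> g1 y) ->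
  2 * #|T| <= 3 * #|~: A|.
Proof.
move=> inj0 inj1 out ne.
have disj : [disjoint g0 @: A & g1 @: A].
  apply/pred0P => z /=; apply/negP => /andP[/imsetP[x Hx ->] /imsetP[y Hy E]].
  exact: ne Hx Hy E.
have : #|g0 @: A :|: g1 @: A| <= #|~: A|.
  apply/subset_leq_card/subsetP => z; rewrite inE.
  by case/orP=> /imsetP[x /out[H0 H1] ->]; rewrite inE.
rewrite cardsU disjoint_setI0 // cards0 subn0 !card_imset // -(cardsC A).
by lia.
Qed.

Lemma balance_addb (N n : nat) (l r ol orr : 'I_n -> nat) (h h' f : nat -> nat -> bool) :
  n <= N -> (forall v, [&& l v < r v, r v < N.*2, ol v < N.*2 & orr v < N.*2]) ->
  (forall x o, x <= N.*2 -> o <= N.*2 -> h' x o = h x o (+) f x o) ->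
  balance l r ol orr h' = balance l r ol orr h (+) balance l r ol orr f.
Proof.
move=> nN bound E; rewrite /balance !E // ?leq_double // [RHS]addbACA.
congr addb; last exact: addbACA.
rewrite -big_split; apply: eq_bigr => v _; have := bound v => /and4P[H1 H2 H3 H4].
by rewrite /node_balance /= !E; lia.
Qed.

Section Flip.

Variables (N : nat) (f : nat -> nat -> bool) (m : nat).

(** Adds [f] to the truth table number [j]; the divisions by [2 N + 1] decode the index used in
    [hash]. *)
Definition flip (j : nat) (r : m.-tuple bool) : m.-tuple bool :=
  [tuple tnth r i (+) ((i %/ N.*2.+1 %/ N.*2.+1 == j) &&
                       f (i %/ N.*2.+1 %% N.*2.+1) (i %% N.*2.+1)) | i < m].

Lemma flipK (j : nat) : involutive (flip j).
Proof. by move=> r; apply: eq_from_tnth => i; rewrite !tnth_mktuple -addbA addbb addbF. Qed.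

Lemma hash_flip (j k x o : nat) (r : m.-tuple bool) :
  m = 2 * (N.*2.+1 * N.*2.+1) -> k < 2 -> x <= N.*2 -> o <= N.*2 ->
  hash N (flip j r) k x o = hash N r k x o (+) ((k == j) && f x o).
Proof.
rewrite /hash; set W := N.*2.+1 => Em Hk Hx Ho; set i := (k * W + x) * W + o.
have Hi : i < m by rewrite Em /i; have : k * W <= W; [case: k Hk {i} => [|[|]] //; lia | nia].
have Edo : i %/ W = k * W + x by rewrite /i divnMDl // divn_small ?addn0.
have Emo : i %% W = o by rewrite /i modnMDl modn_small.
have -> : nth false (flip j r) i = tnth (flip j r) (Ordinal Hi) by rewrite (tnth_nth false).
have -> : nth false r i = tnth r (Ordinal Hi) by rewrite (tnth_nth false).
by rewrite tnth_mktuple /= -/W Edo Emo divnMDl // modnMDl divn_small // modn_small // addn0.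
Qed.

End Flip.

Section Bounds.

Variables (c0 K N n : nat).
Hypotheses (c0_gt0 : 0 < c0) (n_gt0 : 0 < n) (nN : n <= N) (Nn : N <= n ^ c0).

(** Nodes compute widths from [N] while the budget counts in [n]; the bound [N <= n ^ c0] costs a
    factor [c0]. *)
Lemma log_bound : (trunc_log 2 N).+1 <= c0 * (trunc_log 2 n).+1.
Proof.
have N_gt0 : 0 < N by apply: leq_trans nN.
rewrite -(ltn_exp2l _ _ (ltnSn 1)); apply: leq_ltn_trans (trunc_logP (ltnSn 1) N_gt0) _.
apply: (leq_ltn_trans Nn); rewrite mulnC expnM ltn_exp2r //.
exact: trunc_log_ltn.
Qed.

Lemma width_bound : width c0 N <= (c0 * c0).+1 * (trunc_log 2 n).+1.
Proof.
have := log_bound; rewrite /width.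
move: (trunc_log 2 N).+1 (trunc_log 2 n) => a b H.
have : c0 * a <= c0 * (c0 * b.+1) by rewrite leq_mul2l H orbT.
by rewrite mulnA mulSn; lia.
Qed.

Lemma width_budget : 8 * width c0 N + 2 <= budget (8 * (c0 * c0).+1 + 2) n.
Proof.
have := width_bound; rewrite /budget mulnDl -mulnA.
by move: (_ * (trunc_log 2 n).+1) => a; lia.
Qed.

Lemma double_lt_width : N.*2 < 2 ^ width c0 N.
Proof.
rewrite expnS -muln2 mulnC ltn_pmul2l //.
apply: (leq_trans (trunc_log_ltn N (ltnSn 1))).
by rewrite leq_exp2l // leq_pmull.
Qed.

Lemma exp_lt_width : n ^ c0 < 2 ^ width c0 N.
Proof.
apply: (@leq_ltn_trans (N ^ c0)); first by rewrite leq_exp2r.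
apply: (@leq_trans (2 ^ (c0 * (trunc_log 2 N).+1))); last by rewrite leq_exp2l.
by rewrite mulnC expnM ltn_exp2r // trunc_log_ltn.
Qed.

End Bounds.

Lemma circle_protocol_messages (c0 : nat) : 0 < c0 ->
  messages_bounded c0 (8 * (c0 * c0).+1 + 2) (circle_protocol c0).
Proof.
move=> c0_gt0 n N i r c1 c2 n_gt0 /andP[nN Nn] _ _ _ _.
apply: leq_trans (width_budget c0_gt0 n_gt0 nN Nn).
rewrite -[msg _]/(message c0) /message !size_cat size_bits_of !size_take_min.
by move: (width c0 N) => w; lia.
Qed.

Lemma circle_protocol_complete (c0 : nat) : 0 < c0 ->
  completeness c0 (8 * (c0 * c0).+1 + 2) (circle_protocol c0).
Proof.
move=> c0_gt0 N n adj id [n_gt0 [/andP[nN Nn] [[sym irr] [conn [id_inj Hid]]]]] circ.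
have id_gt0 v : 0 < id v by case/andP: (Hid v).
have id_lt v : id v < 2 ^ width c0 N.
  by apply: leq_ltn_trans (exp_lt_width c0_gt0 nN); case/andP: (Hid v).
have [l [r model]] := circle_graph_chord_model circ.
have [root [par [sz [X [Hpar Hsz Hcheck Hfp]]]]] :=
  honest_labels n_gt0 sym conn id_inj id_gt0 nN irr model.
set ol := fun v => opened l r (l v) in Hcheck Hfp.
set orr := fun v => opened l r (r v).+1 in Hcheck Hfp.
pose labels v := [:: id root; par v; sz v; l v; r v; ol v; orr v].
pose c1 v := encode (width c0 N) (labels v).
pose c2 s v := [:: X (hash N s 0) v; X (hash N s 1) v].
have small x : x <= N.*2 -> x < 2 ^ width c0 N.
  by move=> H; apply: leq_ltn_trans H (double_lt_width _ c0_gt0).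
have Hlabels v : all (fun x => x < 2 ^ width c0 N) (labels v).
  have par_lt : par v < 2 ^ width c0 N by case: (Hpar v) => [->|[u ->//]]; rewrite expn_gt0.
  have /and5P[_ _ _ H1 /and3P[/and3P[H2 H3 H4] _ _]] := Hcheck v.
  by rewrite /= id_lt par_lt !small //; try lia; have := Hsz v; lia.
have field_c1 i v : i < 7 -> field (width c0 N) i (c1 v) = nth 0 (labels v) i.
  by move=> Hi; apply: field_encode.
have budgetP := width_budget c0_gt0 n_gt0 nN Nn.
exists c1; split.
  by move=> v; apply: leq_trans budgetP; rewrite size_encode /=; lia.
exists c2; split.
  by move=> s v; apply: leq_trans budgetP; rewrite /=; lia.
(* The honest certificates are accepted for all coins: completeness is perfect. *)
rewrite [X in 3 * X](_ : _ = 2 ^ rlen (circle_protocol c0) N); first by rewrite leq_mul2r orbT.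
rewrite -[in RHS]card_bool -card_tuple -cardsT; apply: eq_card => s; rewrite !inE.
apply/all_acceptP => //; split; last split.
- by move=> v; rewrite size_encode.
- move=> v; move: (Hcheck v); congr is_true; symmetry; rewrite -[in LHS](map_id (enum (adj v))).
  by apply: (@local_check_map _ _ _ idfun) => x //=; rewrite field_c1.
- move=> j Hj v; move: (Hfp (hash N s j) v); congr is_true; symmetry.
  rewrite -[in LHS](map_id (enum (adj v))).
  apply: (@fingerprint_check_map _ _ idfun) => x //=; rewrite ?field_c1 //.
  by case: j Hj => [|[|]].
Qed.

Lemma circle_protocol_sound (c0 K : nat) : 0 < c0 -> soundness c0 K (circle_protocol c0).
Proof.
move=> c0_gt0 N n adj id [n_gt0 [/andP[nN Nn] [[sym _] [conn [id_inj Hid]]]]] ncirc c1 _ c2 _.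
have id_gt0 v : 0 < id v by case/andP: (Hid v).
have id_lt v : id v < 2 ^ width c0 N.
  by apply: leq_ltn_trans (exp_lt_width c0_gt0 nN); case/andP: (Hid v).
set m := rlen _ N.
pose A := [set s : m.-tuple bool |
  all_accept (circle_protocol c0) N adj id c1 (c2 (val s)) (val s)].
rewrite [X in 3 * #|pred_of_set X|](_ : _ = ~: A); last by apply/setP => s; rewrite !inE.
have -> : 2 ^ m = #|{: m.-tuple bool}| by rewrite card_tuple card_bool.
(* The local checks do not involve the coins, so a single accepted string [s0] yields them. *)
have [A0|[s0]] := set_0Vmem A; first by rewrite A0 setC0 cardsT leq_mul2r orbT.
rewrite inE => /(all_acceptP _ _ _ _ id_lt)[_ [Hloc _]].
set w := width c0 N in id_lt Hloc.
pose f i v := field w i (c1 v).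
apply: contraT => Hneg; exfalso; apply: ncirc.
apply: (@chord_model_circle_graph _ _ (f 3) (f 4)).
(* If some [h] had odd balance, adding it to either table would turn accepted coins into rejected
   ones and give the bound after all. *)
apply: (local_check_sound sym Hloc) => h; apply/negP => Hh; case/negP: Hneg.
pose B k s := balance (f 3) (f 4) (f 5) (f 6) (hash N s k).
have BA k s : k < 2 -> s \in A -> B k (val s) = false.
  move=> Hk; rewrite inE => /(all_acceptP _ _ _ _ id_lt)[_ [_ /(_ k Hk) Hfp]].
  exact: (fingerprint_check_sound n_gt0 sym conn id_inj id_gt0 Hloc Hfp).
(* By linearity, adding [h] to table [j] toggles the balance of that table only. This also separates
   the two images, by the balance of table 0. *)
have Bflip j k (s : m.-tuple bool) : k < 2 -> B k (flip N h j s) = B k s (+) (k == j).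
  move=> Hk.
  rewrite /B (@balance_addb N _ _ _ _ _ (hash N s k) _ (fun x o => (k == j) && h x o)) //.
  - congr addb; case: (k == j) => //=.
    by rewrite /balance big1.
  - by move=> v; have /and5P[_ _ _ -> /and3P[/and3P[-> -> ->] _ _]] := Hloc v.
  - by move=> x o Hx Ho; apply: hash_flip.
apply: (@two_disjoint_copies _ A (flip N h 0) (flip N h 1)).
- exact: inv_inj (flipK _ _ _).
- exact: inv_inj (flipK _ _ _).
- move=> s Hs; split; apply/negP.
    by move/(BA 0 _ isT); rewrite Bflip // BA.
  by move/(BA 1 _ isT); rewrite Bflip // BA.
- move=> s t Hs Ht E; have := Bflip 0 0 s isT; rewrite E Bflip // !BA //.
Qed.

Unset Implicit Arguments.

(* Circle-Recognition is in dMAM[log n]: for every polynomial bound n^c0 (on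
   identifiers and on the known upper bound N of n), there is a dMAM protocol
   with certificates and messages of O(log n) bits deciding circle graphs. *)
Theorem theorem3 (c0 : nat) : 1 <= c0 ->
  exists (K : nat) (P : protocol),
    messages_bounded c0 K P /\ completeness c0 K P /\ soundness c0 K P.
Proof.
move=> c0_gt0; exists (8 * (c0 * c0).+1 + 2), (circle_protocol c0).
split; first exact: circle_protocol_messages.
by split; [apply: circle_protocol_complete | apply: circle_protocol_sound].
Qed.
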